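(* Let $G$ be a finite group and let $S$ be a set of generators of $G$ with $e\in S=S^{-1}$. Suppose that $G$ acts transitively on a finite set $V$, and let $\mathfrak{X}_S$ be the configuration coming from the Schreier graph $\mathrm{Sch}(V,S)$. Then the number $WL(\mathfrak{X}_S)$ of nontrivial iterations of the Weisfeiler-Leman algorithm applied to $\mathfrak{X}_S$ satisfies $$WL(\mathfrak{X}_S)\leq \log_2 \mathrm{diam}\,\mathrm{Sch}(V,S)+3 .$$
   Context: The Schreier graph $\mathrm{Sch}(V,S)$ has vertex set $V$ and (multi)edge set $\{(v,sv): v\in V, s\in S\}$; its diameter is the maximum over ordered pairs of vertices of the length of a shortest directed path between them (finite since $S$ generates $G$ and the action is transitive). The configuration $\mathfrak{X}_S$ is the pair $(V,c)$ with colouring $c:V^2\to\mathcal{P}(S)$, $c(v_1,v_2)=\{s\in S: sv_1=v_2\}$. Weisfeiler-Leman algorithm: for a set $\Gamma$ with colouring $c:\Gamma^2\to\mathcal{C}$, put $c^{(0)}=c$, $\mathcal{C}^{(0)}=\mathcal{C}$, and define $c^{(h+1)}(v_1,v_2)$ to be the tuple consisting of $c^{(h)}(v_1,v_2)$ together with the family of numbers $\left|\{w\in\Gamma: c^{(h)}(v_1,w)=c_1,\ c^{(h)}(w,v_2)=c_2\}\right|$ indexed by $(c_1,c_2)\in\mathcal{C}^{(h)}\times\mathcal{C}^{(h)}$; $\mathcal{C}^{(h+1)}$ is the set of values of $c^{(h+1)}$. Each $c^{(h+1)}$ refines $c^{(h)}$. The number of nontrivial iterations $WL$ is the least $h\geq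 0$ such that the partition of $\Gamma^2$ into colour classes of $c^{(h+1)}$ equals that of $c^{(h)}$ (i.e. the final iteration producing no refinement is not counted). *)

(* Defs.v *)
From HB Require Import structures.
From mathcomp Require Import all_boot all_fingroup.

Set Implicit Arguments.
Unset Strict Implicit.
Unset Printing Implicit Defensive.

Section WeisfeilerLeman.

Variable V : finType.

Record configuration := Configuration {
  colour : finType;
  col : V -> V -> colour
}.

Definition wl_tuple (X : configuration) (v1 v2 : V) :
    colour X * {ffun colour X * colour X -> nat} :=
  (col X v1 v2,
   [ffun c => #|[set w | (col X v1 w == c.1) && (col X w v2 == c.2)]|]).

Definition wl_values (X : configuration) :
    seq (colour X * {ffun colour X * colour X -> nat}) :=
  codom (fun p : V * V => wl_tuple X p.1 p.2).

Definition wl_refine (X : configuration) : configuration :=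
  @Configuration (seq_sub (wl_values X))
    (fun v1 v2 => SeqSub (codom_f (fun p => wl_tuple X p.1 p.2) (v1, v2))).

Definition wl_iter (h : nat) (X : configuration) : configuration :=
  iter h wl_refine X.

Definition colour_classes (X : configuration) : {set {set V * V}} :=
  preim_partition (fun p => col X p.1 p.2) [set: V * V].

Definition wl_stable (X : configuration) (h : nat) : bool :=
  colour_classes (wl_iter h.+1 X) == colour_classes (wl_iter h X).

Lemma wl_refineP (X : configuration) (p q : V * V) :
  col (wl_refine X) p.1 p.2 = col (wl_refine X) q.1 q.2 ->
  col X p.1 p.2 = col X q.1 q.2.
Proof. by move=> /(congr1 val) /= [->]. Qed.

Lemma wl_stable_ex (X : configuration) : exists h, wl_stable X h.
Proof.
pose E (Y : configuration) : {set (V * V) * (V * V)} :=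
  [set pq | col Y pq.1.1 pq.1.2 == col Y pq.2.1 pq.2.2].
have Esub Y : E (wl_refine Y) \subset E Y.
  by apply/subsetP=> pq; rewrite !inE => /eqP /wl_refineP ->.
have Eeq Y Z : E Y = E Z -> colour_classes Y = colour_classes Z.
  move=> eqE; apply: eq_imset => p; apply/setP=> q; rewrite !inE /=.
  by have /setP/(_ (p, q)) := eqE; rewrite !inE.
suff main n Y : #|E Y| <= n -> exists h, wl_stable Y h by exact: main (leqnn _).
elim: n Y => [|n IHn] Y leYn.
  exists 0; apply/eqP/Eeq/eqP; rewrite eqEcard Esub.
  exact: leq_trans leYn _.
have [eqE|ltE] := eqVproper (Esub Y); first by exists 0; apply/eqP/Eeq.
have [h sth] := IHn (wl_refine Y) (leq_trans (proper_card ltE) leYn).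
by exists h.+1; rewrite /wl_stable /wl_iter !iterSr in sth *.
Qed.

Definition WL (X : configuration) : nat := ex_minn (wl_stable_ex X).

End WeisfeilerLeman.

Section Diameter.

Variables (V : finType) (e : rel V).

Definition walk_of_length (v w : V) (n : nat) : bool :=
  [exists p : n.-tuple V, path e v p && (last v p == w)].

(* The search is bounded by #|V|, which a shortest path never exceeds; the    *)
(* value is #|V| when w is not reachable from v.                              *)
Definition distance (v w : V) : nat :=
  [arg min_(n < (ord_max : 'I_#|V|.+1) | walk_of_length v w n) n].

Definition diameter : nat := \max_(p : V * V) distance p.1 p.2.

Lemma walk_of_lengthP (v w : V) (n : nat) :
  reflect (exists p, [/\ path e v p, last v p = w & size p = n])
          (walk_of_length v w n).
Proof.
apply: (iffP existsP) => [[p /andP[ep /eqP lp]]|[p [ep lp /eqP sp]]].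
  by exists p; rewrite size_tuple.
by exists (Tuple sp); rewrite /= ep lp eqxx.
Qed.

Lemma distanceP (v w : V) : connect e v w ->
  walk_of_length v w (distance v w) /\
  (forall n, walk_of_length v w n -> distance v w <= n).
Proof.
have short p : path e v p -> last v p = w ->
    exists2 n : 'I_#|V|.+1, walk_of_length v w n & n <= size p.
  move=> ep; case/shortenP: ep => q ep uq sub lp.
  have ltq : size q < #|V|.+1.
    by rewrite ltnS; apply/ltnW/(leq_trans _ (max_card (mem (v :: q))));
       rewrite (card_uniqP uq).
  exists (Ordinal ltq); first by apply/walk_of_lengthP; exists q.
  by rewrite uniq_leq_size //; case/andP: uq.
case/connectP=> p ep lp; have [n0 wn0 _] := short p ep (esym lp).
rewrite /distance /arg_min /extremum; case: pickP => [m|none].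
  case/andP=> wm /forallP minm; split=> // n /walk_of_lengthP[q [eq_ lq <-]].
  have [k wk] := short q eq_ lq; apply: leq_trans.
  by have /implyP := minm k; apply.
have [m wm minm] := @arg_minnP _ n0 (fun n : 'I_#|V|.+1 => walk_of_length v w n)
  (fun n => n : nat) wn0.
have /negP[] := negbT (none m); rewrite /= wm /=.
by apply/forallP=> k; apply/implyP=> wk; apply: minm.
Qed.

End Diameter.

Section Schreier.

Variables (gT : finGroupType) (G : {group gT}) (V : finType).
Variables (to : action G V) (S : {set gT}).

(* Actions in MathComp are right actions: the left action of G that            *)
(* corresponds to [to] is s v = to v s^-1.                                     *)
Definition lact (s : gT) (v : V) : V := to v s^-1%g.

Definition schreier_edge : rel V :=
  [rel v w | [exists s in S, lact s v == w]].

Definition schreier_configuration : configuration V :=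
  @Configuration V {set gT} (fun v1 v2 => [set s in S | lact s v1 == v2]).

End Schreier.

(* Main.v *)
Require Import Defs.
From HB Require Import structures.
From mathcomp Require Import all_boot all_order all_fingroup all_algebra.
From mathcomp Require Import reals exp.

(** After [h] iterations the colour of [(v, w)] determines which elements of
    [S ^+ (2 ^ h)] carry [v] to [w]. Let [d] be the diameter. Once
    [2 ^ h >= 2 d + 1], one more iteration makes the colour of [(v, w)] determine
    the products of [2 d + 1] generators that fix [v]; as in Schreier's lemma,
    these suffice to define an equivariant bijection of [V] sending [v] to any
    [v'] whose pair [(v', w')] has the same colour, and this bijection sends [w]
    to [w']. Equivariant bijections preserve the colours of all iterations, so
    there is no further refinement. *)

Import GroupScope.

(* [matrix.col] shadows [Defs.col]. *)
Local Notation col := Defs.col.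

Section Refinement.

Set Implicit Arguments.
Unset Strict Implicit.

Variables (V : finType) (X : configuration V).

(** The refined colour counts the intermediate vertices with each pair of colours, and [u] makes one
    such count positive. *)
Lemma col_wl_iterS_split (h : nat) (v w v' w' u : V) :
  col (wl_iter h.+1 X) v w = col (wl_iter h.+1 X) v' w' ->
  exists u', col (wl_iter h X) v' u' = col (wl_iter h X) v u /\
             col (wl_iter h X) u' w' = col (wl_iter h X) u w.
Proof.
move=> /(congr1 val) /= [_ /ffunP].
move/(_ (col (wl_iter h X) v u, col (wl_iter h X) u w)); rewrite !ffunE /= => eqc.
have : 0 < #|[set u' | (col (wl_iter h X) v' u' == col (wl_iter h X) v u)
                       && (col (wl_iter h X) u' w' == col (wl_iter h X) u w)]|.
  by rewrite -eqc; apply/card_gt0P; exists u; rewrite inE !eqxx.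
by case/card_gt0P=> u'; rewrite inE => /andP[/eqP ? /eqP ?]; exists u'.
Qed.

(** By induction, [f] maps the intermediate vertices counted for [(v, w)] bijectively to those
    counted for [(f v, f w)]. *)
Lemma col_wl_iter_automorphism (f : V -> V) :
  bijective f -> (forall v w, col X (f v) (f w) = col X v w) ->
  forall h v w, col (wl_iter h X) (f v) (f w) = col (wl_iter h X) v w.
Proof.
move=> bijf fX; elim=> [|h IHh] v w; first exact: fX.
apply: val_inj; rewrite /= /wl_tuple IHh; congr (_, _).
apply/ffunP=> c; rewrite !ffunE -[RHS](card_imset _ (bij_inj bijf)).
apply: eq_card => x; have [g _ fK] := bijf.
rewrite inE -[x]fK (mem_imset _ _ (bij_inj bijf)) inE.
by rewrite !IHh.
Qed.

Lemma WL_leq (h : nat) :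
  (forall v w v' w', col (wl_iter h X) v w = col (wl_iter h X) v' w' ->
     col (wl_iter h.+1 X) v w = col (wl_iter h.+1 X) v' w') ->
  WL X <= h.
Proof.
move=> stab; rewrite /WL; case: ex_minnP => m _; apply.
apply/eqP/eq_imset => p; apply/setP=> q; rewrite !inE /=.
by apply/eqP/eqP => [/wl_refineP|/stab].
Qed.

End Refinement.

Section SchreierWL.

Set Implicit Arguments.
Unset Strict Implicit.

Variables (gT : finGroupType) (G : {group gT}) (S : {set gT}).
Variables (V : finType) (to : action G V).
Hypotheses (genS : <<S>> = G) (S1 : 1 \in S) (SV : S = S^-1).
Hypothesis transG : [transitive G, on [set: V] | to].

Local Notation X := (schreier_configuration to S).
Local Notation edge := (schreier_edge to S).
Local Notation d := (diameter edge).

Let SG : S \subset G. Proof. by rewrite -genS subset_gen. Qed.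

Let invS s : (s^-1 \in S) = (s \in S).
Proof. by rewrite {2}SV inE. Qed.

Lemma generator_exp_subG n : S ^+ n \subset G.
Proof.
elim: n => [|n IHn]; first by rewrite expg0 sub1G.
by rewrite expgS mul_subG.
Qed.

Let SnG n g : g \in S ^+ n -> g \in G.
Proof. exact: (subsetP (generator_exp_subG n)). Qed.

Lemma generator_exp1 n : 1 \in S ^+ n.
Proof.
elim: n => [|n IHn]; first by rewrite expg0 inE.
by rewrite expgS -[1]mulg1 mem_mulg.
Qed.

(** Shorter products are padded with [1], so [S ^+ n] is the ball of radius [n]. *)
Lemma generator_exp_mono m n : m <= n -> S ^+ m \subset S ^+ n.
Proof.
move=> /subnKC <-; rewrite expgD; apply/subsetP=> g gm.
by rewrite -[g]mulg1 mem_mulg ?generator_exp1.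
Qed.

Lemma generator_expV n g : g \in S ^+ n -> g^-1 \in S ^+ n.
Proof.
elim: n g => [|n IHn] g; first by rewrite expg0 !inE => /eqP->; rewrite invg1.
rewrite expgS => /mulsgP[s t sS tn ->]; rewrite -expgS expgSr invMg.
by rewrite mem_mulg ?invS // IHn.
Qed.

Let toM n g : g \in S ^+ n -> forall m h, h \in S ^+ m ->
  forall v, to v (g * h) = to (to v g) h.
Proof. by move=> gn m h hm v; rewrite actMin ?(SnG gn) ?(SnG hm). Qed.

Let S_exp1 s : s \in S -> s \in S ^+ 1. Proof. by rewrite expg1. Qed.

Let toKV n g : g \in S ^+ n -> forall v, to (to v g) g^-1 = v.
Proof. by move=> gn v; rewrite -(toM gn (generator_expV gn)) mulgV act1. Qed.

Lemma schreier_edgeP v w :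
  reflect (exists2 s, s \in S & to v s = w) (edge v w).
Proof.
apply: (iffP existsP) => [[s /andP[sS /eqP <-]]|[s sS <-]].
  by exists s^-1; rewrite ?invS.
by exists s^-1; rewrite invS sS /lact invgK eqxx.
Qed.

Lemma schreier_walkP v w n :
  reflect (exists2 g, g \in S ^+ n & to v g = w) (walk_of_length edge v w n).
Proof.
apply: (iffP (walk_of_lengthP _ _ _ _)) => [[p []]|].
  elim: p v n => [|u p IHp] v n /=; first by move=> _ <- <-; exists 1; rewrite ?act1 ?inE.
  case/andP=> /schreier_edgeP[s sS <-] ep lp <-.
  have [g gp <-] := IHp _ _ ep lp erefl.
  by exists (s * g); rewrite ?(toM (S_exp1 sS) gp) // expgS mem_mulg.
elim: n v => [|n IHn] v [g].
  by rewrite expg0 inE => /eqP-> <-; rewrite act1; exists [::].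
rewrite expgS => /mulsgP[s t sS tn ->]; rewrite (toM (S_exp1 sS) tn) => ew.
have [|p [ep lp sp]] := IHn (to v s); first by exists t.
exists (to v s :: p); split=> //=; last by rewrite sp.
by rewrite ep andbT; apply/schreier_edgeP; exists s.
Qed.

Lemma schreier_connected v w : connect edge v w.
Proof.
have [g gG ew] : exists2 g, g \in G & to v g = w.
  case/imsetP: transG => x _ defV.
  have /orbitP[a aG <-] : v \in orbit to G x by rewrite -defV inE.
  have /orbitP[b bG <-] : w \in orbit to G x by rewrite -defV inE.
  by exists (a^-1 * b); rewrite ?groupM ?groupV // -actMin ?mulKVg ?groupM ?groupV.
have [n gen_n] := gen_expgs S.
(* [gen_expgs] gives [<<S>>] as a power of [1 |: S], which is [S] itself. *)
move: gG; rewrite -genS gen_n (setUidPr _) ?sub1set // => gn.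
have /walk_of_lengthP[p [ep lp _]] : walk_of_length edge v w n.
  by apply/schreier_walkP; exists g.
by apply/connectP; exists p.
Qed.

Lemma diameter_reach v w : exists2 g, g \in S ^+ d & to v g = w.
Proof.
have [/schreier_walkP[g gn ew] _] := distanceP (schreier_connected v w).
exists g => //; apply: subsetP gn; apply: generator_exp_mono.
exact: (leq_bigmax (F := fun p => distance edge p.1 p.2) (v, w)).
Qed.

(** A product of [2 ^ h.+1] generators is cut into halves [g1] and [g2]. The midpoint [to v g1] has
    a counterpart [u'] with matching colours, which the induction hypothesis identifies as
    [to v' g1]. *)
Lemma col_wl_iter_exp h v w v' w' :
  col (wl_iter h X) v w = col (wl_iter h X) v' w' ->
  forall g, g \in S ^+ (2 ^ h) -> to v g = w -> to v' g = w'.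
Proof.
elim: h v w v' w' => [|h IHh] v w v' w' eqc g.
  (* Since [lact] inverts its group element, [g] is read off from the label [g^-1]. *)
  rewrite expg1 => gS ew; move/setP: eqc => /(_ g^-1).
  by rewrite !inE invS gS /lact invgK ew eqxx => /esym/eqP.
rewrite expnS mul2n -addnn expgD => /mulsgP[g1 g2 g1n g2n ->].
rewrite !(toM g1n g2n) => ew.
have [u' [eq1 eq2]] := col_wl_iterS_split (to v g1) eqc.
by rewrite (IHh _ _ _ _ (esym eq1) g1 g1n erefl) (IHh _ _ _ _ (esym eq2) g2).
Qed.

(** Taking [v] itself as intermediate vertex gives a counterpart [u']; as [1] carries [v] to [v], it
    carries [v'] to [u'], so [u'] is [v']. *)
Lemma col_wl_iterS_diag h v w v' w' :
  col (wl_iter h.+1 X) v w = col (wl_iter h.+1 X) v' w' ->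
  col (wl_iter h X) v v = col (wl_iter h X) v' v'.
Proof.
case/(col_wl_iterS_split v) => u' [eqc _].
have := col_wl_iter_exp (esym eqc) (generator_exp1 _); rewrite !act1 => /(_ erefl).
by move=> eu; rewrite -eqc -eu.
Qed.

(** The map sends [to v g] to [to v' g]; the hypothesis on stabilizing products makes this
    independent of the choice of [g]. *)
Lemma equivariant_bijection v v' :
  (forall g, g \in S ^+ d.*2.+1 -> to v g = v -> to v' g = v') ->
  exists f : V -> V, [/\ bijective f,
    forall s x, s \in S -> f (to x s) = to (f x) s &
    forall g, g \in S ^+ d -> f (to v g) = to v' g].
Proof.
move=> fixv.
have /fin_all_exists2[t td tv] x := diameter_reach v x.
(* Length [d.+1] is needed to compare [t x * s] with [t (to x s)]; with the inverse of a
   representative of length [d] this makes [d.*2.+1]. *)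
have indep g x : g \in S ^+ d.+1 -> to v g = x -> to v' g = to v' (t x).
  move=> gd ex; have tVd := generator_expV (td x).
  have gtd : g * (t x)^-1 \in S ^+ d.*2.+1.
    by rewrite -addnn -addSn expgD mem_mulg.
  have := fixv _ gtd; rewrite !(toM gd tVd) ex -{1}(tv x) (toKV (td x)).
  move=> /(_ erefl) ev; rewrite -[in RHS]ev.
  by have := toKV tVd (to v' g); rewrite invgK.
pose f x := to v' (t x).
have fS s x : s \in S -> f (to x s) = to (f x) s.
  move=> sS; rewrite /f -(toM (td x) (S_exp1 sS)); symmetry; apply: indep.
    by rewrite expgSr mem_mulg.
  by rewrite (toM (td x) (S_exp1 sS)) tv.
have fv g : g \in S ^+ d -> f (to v g) = to v' g.
  move=> gd; symmetry; apply: indep => //.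
  exact: subsetP (generator_exp_mono (leqnSn _)) _ gd.
exists f; split=> //.
(* Every point is within distance [d] of [v'], so [f] is onto, hence bijective by finiteness. *)
have /fin_all_exists[f' f'K] : forall x, exists y, f y = x.
  move=> x; have [g gd <-] := diameter_reach v' x.
  by exists (to v g); rewrite fv.
have inj_f' : injective f' by apply: can_inj f'K.
by have [k f'k kf'] := injF_bij inj_f'; exists f' => // x; rewrite -[x]kf' f'K.
Qed.

Lemma WL_schreier_leq h : d.*2 < 2 ^ h -> WL X <= h.+1.
Proof.
move=> dh; apply: WL_leq => v w v' w' eqc.
have [|f [bijf fS fv]] := @equivariant_bijection v v'.
  move=> g gd; apply: (col_wl_iter_exp (col_wl_iterS_diag eqc)).
  exact: subsetP (generator_exp_mono dh) _ gd.
have fv1 : f v = v'.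
  by have := fv 1 (generator_exp1 _); rewrite !act1.
have fw : f w = w'.
  have [g gd ew] := diameter_reach v w; rewrite -ew fv //.
  apply: (col_wl_iter_exp eqc) => //; apply: subsetP gd.
  apply: generator_exp_mono; rewrite expnS mul2n -addnn.
  by apply/ltnW/(leq_trans _ (leq_addr _ _))/(leq_trans _ dh); rewrite ltnS -addnn leq_addr.
rewrite -fv1 -fw col_wl_iter_automorphism // => x y.
apply/setP=> s; rewrite !inE; have [sS|//] := boolP (s \in S).
by rewrite /= /lact -fS ?invS // (inj_eq (bij_inj bijf)).
Qed.

End SchreierWL.

Import Order.TTheory GRing.Theory Num.Theory.

Local Open Scope ring_scope.

Theorem theorem1 (R : realType) (gT : finGroupType) (G : {group gT})
    (S : {set gT}) (V : finType) (to : action G V)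
    (genS : <<S>>%g = G)
    (S1 : 1%g \in S)
    (SV : S = S^-1%g)
    (transG : [transitive G, on [set: V] | to]) :
  (WL (schreier_configuration to S))%:R
    <= ln ((diameter (schreier_edge to S))%:R : R) / ln 2 + 3.
Proof.
set d := diameter _.
have ln2_gt0 : 0 < ln 2 :> R by rewrite ln_gt0 // ltr1n.
have : (WL (schreier_configuration to S) <= trunc_log 2 d + 3)%N.
  (* From [d < 2 ^ (trunc_log 2 d + 1)], doubling gives the exponent [trunc_log 2 d + 2]; the third
     extra iteration is the one that yields diagonal colours. *)
  rewrite addnS; apply: WL_schreier_leq => //.
  rewrite -/d addn2 expnS mul2n ltn_double; exact: trunc_log_ltn.
rewrite -(ler_nat R) => /le_trans; apply; rewrite natrD lerD2r.
(* For [d = 0] both logarithms take the default value [0]. *)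
have [->|d_gt0] := posnP d; first by rewrite trunc_log0 ln0 // mul0r.
rewrite ler_pdivlMr // mulr_natl -lnXn // ler_ln ?posrE ?exprn_gt0 ?ltr0n //.
by rewrite -natrX ler_nat trunc_logP.
Qed.
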